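(* Let $\mathscr H_\kappa$ be a functional Hilbert space with property (A). Suppose $\mathscr H_\kappa$ is an algebra under pointwise product and the spectrum of the operator $M_z$ of multiplication by $z$ on $\mathscr H_\kappa$ equals $\overline{\mathbb D}$. Then every function in $\mathscr H_\kappa$ extends continuously to $\overline{\mathbb D}$ (i.e. $\mathscr H_\kappa\subseteq C(\overline{\mathbb D})$), and every closed $M_z$-invariant subspace of $\mathscr H_\kappa$ is an ideal. Furthermore, for $f\in\mathscr H_\kappa$ the following are equivalent: (a) $f$ is cyclic, i.e. the smallest closed $M_z$-invariant subspace containing $f$ is $\mathscr H_\kappa$; (b) $f$ is invertible in $\mathrm{Mult}(\mathscr H_\kappa)$; (c) (the continuous extension of) $f$ has no zero in $\overline{\mathbb D}$.
   Context: A functional Hilbert space with property (A) is a reproducing kernel Hilbert space $\mathscr H_\kappa$ of holomorphic functions on the open unit disc $\mathbb D$ with sesqui-analytic reproducing kernel $\kappa$ such that: (A1) $\kappa(w,0)=1$ for all $w\in\mathbb D$; (A2) $zf\in\mathscr H_\kappa$ for every $f\in\mathscr H_\kappa$; (A3) the polynomials are dense in $\mathscr H_\kappa$. $\mathrm{Mult}(\mathscr H_\kappa)=\{\varphi:\varphi f\in\mathscr H_\kappa\ \forall f\in\mathscr H_\kappa\}$, a Banach algebra with the operator norm of $f\mapsto\varphi f$. *)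

(* Defs.v *)
(* Complex numbers: C R := R[i] (from
   mathcomp-real-closed), viewed as a normed module over itself via ^o. *)
From mathcomp Require Import all_boot all_order all_algebra.
From mathcomp Require Import all_classical all_reals all_analysis.
From mathcomp Require Import complex.
Import Order.TTheory GRing.Theory Num.Theory.
Import numFieldNormedType.Exports.

Set Implicit Arguments.
Unset Strict Implicit.
Unset Printing Implicit Defensive.

Local Open Scope ring_scope.
Local Open Scope classical_set_scope.

(** The complex field, with its norm topology, as a normed module over itself. *)
Definition C (R : realType) := (R[i])^o.

(** Open unit disc and closed unit disc. *)
Definition disc (R : realType) := [set z : C R | `|z| < 1].
Definition cdisc (R : realType) := [set z : C R | `|z| <= 1].
Arguments disc R : clear implicits.
Arguments cdisc R : clear implicits.

Section Defs.
Variables (R : realType) (H : completeNormedModType (C R)).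

(** [ip] is an inner product (linear in the first variable) inducing the
    norm of the (complete) normed space H : so H is a Hilbert space. *)
Definition is_inner_product (ip : H -> H -> C R) :=
  [/\ (forall (a : C R) (x y z : H), ip (a *: x + y) z = a * ip x z + ip y z),
      (forall x y : H, ip y x = (ip x y)^*) &
      (forall x : H, ip x x = `|x| ^+ 2)].

(** [kappa] is the reproducing kernel of the functional Hilbert space whose
    elements are realized as functions on the disc through [ev]:
    kappa(., w) belongs to H and represents evaluation at w. *)
Definition is_reproducing_kernel (ip : H -> H -> C R) (ev : H -> C R -> C R)
    (kappa : C R -> C R -> C R) :=
  forall w, disc R w -> exists kw : H,
    (forall z, disc R z -> ev kw z = kappa z w) /\
    (forall f : H, ip f kw = ev f w).

(** A functional Hilbert space (reproducing kernel Hilbert space) of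
    holomorphic functions on the open unit disc:  H is a Hilbert space whose
    elements are identified (through the injective linear map [ev]) with
    holomorphic functions on the disc, with a reproducing kernel. *)
Definition functional_hilbert_space (ip : H -> H -> C R) (ev : H -> C R -> C R)
    (kappa : C R -> C R -> C R) :=
  [/\ is_inner_product ip,
      (forall (a : C R) (f g : H) z, ev (a *: f + g) z = a * ev f z + ev g z),
      (forall f g : H, (forall z, disc R z -> ev f z = ev g z) -> f = g),
      (forall (f : H) z, disc R z -> derivable (ev f) z 1) &
      is_reproducing_kernel ip ev kappa].

(** Elements of H which are polynomials (on the disc). *)
Definition poly_elements (ev : H -> C R -> C R) : set H :=
  [set p | exists q : {poly C R}, forall z, disc R z -> ev p z = q.[z]].

(** Property (A). *)
Definition property_A (ip : H -> H -> C R) (ev : H -> C R -> C R) :=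
  exists kappa : C R -> C R -> C R,
  [/\ functional_hilbert_space ip ev kappa,
      (* (A1) *) (forall w, disc R w -> kappa w 0 = 1),
      (* (A2) *) (forall f : H, exists g : H,
                    forall z, disc R z -> ev g z = z * ev f z) &
      (* (A3) *) closure (poly_elements ev) = setT].

(** [Mz] is the operator of multiplication by z on H. *)
Definition is_Mz (ev : H -> C R -> C R) (Mz : H -> H) :=
  forall (f : H) z, disc R z -> ev (Mz f) z = z * ev f z.

(** H is an algebra under pointwise product. *)
Definition is_algebra (ev : H -> C R -> C R) :=
  forall f g : H, exists h : H, forall z, disc R z -> ev h z = ev f z * ev g z.

(** Bounded linear operators, invertibility in B(H) and spectrum. *)
Definition bounded_linear (S : H -> H) :=
  (forall (a : C R) (x y : H), S (a *: x + y) = a *: S x + S y) /\ continuous S.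

Definition spectrum (T : H -> H) : set (C R) :=
  [set l | ~ exists S : H -> H, [/\ bounded_linear S,
             (forall x, S (T x - l *: x) = x) &
             (forall x, T (S x) - l *: S x = x)]].

(** Closed linear subspaces invariant under T. *)
Definition lin_subspace (M : set H) :=
  M 0 /\ forall (a : C R) (x y : H), M x -> M y -> M (a *: x + y).

Definition closed_invariant_subspace (T : H -> H) (M : set H) :=
  [/\ lin_subspace M, closed M & forall x, M x -> M (T x)].

(** M is an ideal of the algebra H: f in M, g in H  ==>  fg in M. *)
Definition is_ideal (ev : H -> C R -> C R) (M : set H) :=
  forall f g h : H, M f ->
    (forall z, disc R z -> ev h z = ev f z * ev g z) -> M h.

(** f is cyclic: the smallest closed Mz-invariant subspace containing f
    (the intersection of all such) is the whole space. *)
Definition cyclic_vector (T : H -> H) (f : H) :=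
  forall M, closed_invariant_subspace T M -> M f -> M = setT.

(** Multiplier algebra Mult(H) and its invertible elements
    (unit = constant function 1). *)
Definition multiplier (ev : H -> C R -> C R) (phi : C R -> C R) :=
  forall f : H, exists g : H, forall z, disc R z -> ev g z = phi z * ev f z.

Definition invertible_multiplier (ev : H -> C R -> C R) (phi : C R -> C R) :=
  multiplier ev phi /\
  exists psi, [/\ multiplier ev psi &
                  forall z, disc R z -> phi z * psi z = 1].

(** F is a continuous extension of (the function of) f to the closed disc. *)
Definition continuous_extension (ev : H -> C R -> C R) (f : H) (F : C R -> C R) :=
  {within cdisc R, continuous F} /\ forall z, disc R z -> F z = ev f z.

End Defs.

(* Main.v *)
(* Two applications of Zabreiko's lemma (a form of the Baire category argument) make the
   product jointly continuous, so |f(z)| <= K ||f|| on the disc: norm limits of polynomials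
   are uniform limits, which gives the continuous extensions and the ideals.  Polynomials
   without zeros in the closed disc are invertible, factor by factor, by the hypothesis on
   the spectrum.  If f has no zeros there, take a polynomial q close to f; then
   f/q = 1 - (q - f)/q, and it suffices that s/q has a dyadic power of small norm when
   |q| > s.  All 1 - l s/q with |l| <= 1 are invertible, so this is the spectral radius
   formula, obtained here, after Rickart, by averaging resolvents over roots of unity. *)
Require Import Defs.
From mathcomp Require Import all_boot all_order all_algebra.
From mathcomp Require Import all_classical all_reals all_analysis.
From mathcomp Require Import complex ring lra.
Import Order.TTheory GRing.Theory Num.Theory.
Import numFieldNormedType.Exports.
Local Open Scope ring_scope.
Local Open Scope classical_set_scope.

Set Implicit Arguments.
Unset Strict Implicit.

(** * Real-valued norms and their topology *)

Section RealNorm.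
Variables (R : realType) (V : normedModType (C R)).
Implicit Types x y : V.

(* [`|x|] lives in the only partially ordered [C R]. *)
Definition nrm x : R := complex.Re `|x|.

Lemma nrmE x : (nrm x)%:C%C = `|x| :> R[i].
Proof. by apply: RRe_real; exact: normr_real. Qed.

Lemma nrm_ge0 x : 0 <= nrm x.
Proof. by rewrite -ler0c nrmE; exact: (normr_ge0 x). Qed.

Lemma nrm0 : nrm 0 = 0. Proof. by rewrite /nrm normr0. Qed.

Lemma nrm_eq0 x : nrm x = 0 -> x = 0.
Proof. by move=> h; apply/normr0_eq0; rewrite -nrmE h. Qed.

Lemma nrmN x : nrm (- x) = nrm x. Proof. by rewrite /nrm normrN. Qed.

Lemma nrmBC x y : nrm (x - y) = nrm (y - x). Proof. by rewrite -nrmN opprB. Qed.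

Lemma nrmD x y : nrm (x + y) <= nrm x + nrm y.
Proof. rewrite -lecR rmorphD /= !nrmE; exact: ler_normD. Qed.

Lemma nrmB x y : nrm (x - y) <= nrm x + nrm y.
Proof. by rewrite -(nrmN y); exact: nrmD. Qed.

Lemma nrm_dist x y z : nrm (x - z) <= nrm (x - y) + nrm (y - z).
Proof. by rewrite -[x - z](subrKA y); exact: nrmD. Qed.

End RealNorm.

Section RealNormTheory.
Variables (R : realType) (V : normedModType (C R)).
Implicit Types (x y : V) (a b : C R).

Lemma nrmZ a x : nrm (a *: x) = nrm a * nrm x.
Proof. by apply: (@complexI R); rewrite rmorphM /= !nrmE normrZ. Qed.

Lemma nrmM a b : nrm (a * b) = nrm a * nrm b.
Proof. by apply: (@complexI R); rewrite rmorphM /= !nrmE normrM. Qed.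

Lemma nrmR (t : R) : nrm (t%:C%C : C R) = `|t|.
Proof. by rewrite /nrm normc_def /= expr0n addr0 sqrtr_sqr. Qed.

Lemma nrm1 : nrm (1 : C R) = 1.
Proof. by rewrite /nrm normr1. Qed.

Lemma nrm_half : nrm (2^-1 : C R) = 2^-1.
Proof.
by rewrite (_ : 2^-1 = (2^-1 : R)%:C%C) ?nrmR ?ger0_norm// fmorphV rmorph_nat.
Qed.

Lemma nrm_lt a (t : R) : (nrm a < t) = (`|a| < t%:C%C).
Proof. by rewrite -ltcR nrmE. Qed.

Lemma nrm_le a (t : R) : (nrm a <= t) = (`|a| <= t%:C%C).
Proof. by rewrite -lecR nrmE. Qed.

Lemma discE a : disc R a = (nrm a < 1).
Proof. by rewrite nrm_lt. Qed.

Lemma cdiscE a : cdisc R a = (nrm a <= 1).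
Proof. by rewrite nrm_le. Qed.

Lemma nbhs_nrmP x (A : set V) :
  nbhs x A <-> exists2 e : R, 0 < e & forall y, nrm (x - y) < e -> A y.
Proof.
split.
  move=> /nbhs_normP[/= e e0 eA].
  have er : e = (complex.Re e)%:C%C by rewrite RRe_real// gtr0_real.
  exists (complex.Re e); first by rewrite -ltcR -er.
  by move=> y xy; apply: eA; rewrite /= er -nrmE ltcR.
move=> [e e0 eA]; apply/nbhs_normP; exists (e%:C%C : R[i]) => /=.
  by rewrite ltcR.
by move=> y; rewrite /= -nrmE ltcR; exact: eA.
Qed.

Lemma cvg_nrmP (u : nat -> V) x :
  u @ \oo --> x <->
  forall e : R, 0 < e -> exists N, forall n, (N <= n)%N -> nrm (x - u n) < e.
Proof.
split.
  move=> ux e e0.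
  have /ux[N _ h] : nbhs x [set y | nrm (x - y) < e] by apply/nbhs_nrmP; exists e.
  by exists N.
move=> h A /nbhs_nrmP[e e0 eA].
by have [N hN] := h e e0; exists N => // n /= Nn; apply: eA; exact: hN.
Qed.

Lemma closed_nrm (M : set V) : closed M ->
  forall x, (forall e : R, 0 < e -> exists2 y, M y & nrm (x - y) < e) -> M x.
Proof.
move=> cM x h; apply: cM => A /nbhs_nrmP[e e0 eA].
by have [y My xy] := h e e0; exists y; split => //; exact: eA.
Qed.

Lemma nrm_closed (M : set V) :
  (forall x, (forall e : R, 0 < e -> exists2 y, M y & nrm (x - y) < e) -> M x) ->
  closed M.
Proof.
move=> h x cx; apply: h => e e0.
have [y [My xy]] : M `&` [set y | nrm (x - y) < e] !=set0.
  by apply: cx; apply/nbhs_nrmP; exists e.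
by exists y.
Qed.

End RealNormTheory.

(** * Sequences with geometrically decaying increments *)

Section Geometric.
Variable R : realType.

Lemma geom_small (q c e : R) : 0 <= q < 1 -> 0 < e ->
  exists N, forall n, (N <= n)%N -> c * q ^+ n < e.
Proof.
move=> /andP[q0 q1] e0.
have /cvgrPdist_lt/(_ _ e0)[N _ h] : (fun n => c * q ^+ n) @ \oo --> (0 : R).
  rewrite -(mulr0 c); apply: cvgMr; apply: cvg_expr.
  by rewrite ger0_norm.
exists N => n /h /=; rewrite sub0r normrN; apply: le_lt_trans; exact: ler_norm.
Qed.

(** Summing the increments bounds every tail by a geometric one; this gives the Cauchy property and,
    in the limit, the rate. *)
Lemma geom_cvg (V : completeNormedModType (C R)) (u : nat -> V) (c q : R) :
  0 <= q < 1 -> (forall n, nrm (u n.+1 - u n) <= c * q ^+ n) ->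
  exists l, u @ \oo --> l /\ forall n, nrm (l - u n) <= c / (1 - q) * q ^+ n.
Proof.
move=> q01 hu; have /andP[q0 q1] := q01.
have c0 : 0 <= c.
  by rewrite (le_trans (nrm_ge0 _) (le_trans (hu 0%N) _))// expr0 mulr1.
have q1' : 0 < 1 - q by rewrite subr_gt0.
have tail k n : nrm (u (n + k)%N - u n) <= c / (1 - q) * (q ^+ n - q ^+ (n + k)).
  elim: k => [|k IH]; first by rewrite addn0 !subrr nrm0 mulr0.
  rewrite (le_trans (nrm_dist _ (u (n + k)%N) _))//.
  rewrite addnS (le_trans (lerD (hu _) IH))// exprS.
  rewrite le_eqVlt; apply/orP; left; apply/eqP; field.
  by rewrite gt_eqF.
have tail' m n : (n <= m)%N -> nrm (u m - u n) <= c / (1 - q) * q ^+ n.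
  move=> nm; rewrite -(subnKC nm) (le_trans (tail _ _))// ler_wpM2l//.
    by rewrite divr_ge0// ltW.
  by rewrite lerBlDr lerDl exprn_ge0.
have /cvg_ex[l ul] : cvg (u @ \oo).
  apply: cauchy_cvg; apply: cauchy_exP => e e0.
  have er : e = (complex.Re e)%:C%C by rewrite RRe_real// gtr0_real.
  have e0' : 0 < complex.Re e by rewrite -ltcR -er.
  have [N hN] := geom_small (c / (1 - q)) q01 e0'.
  exists (u N), N => // n /= Nn; rewrite -ball_normE /= er -nrmE ltcR nrmBC.
  exact: le_lt_trans (tail' _ _ Nn) (hN _ (leqnn _)).
exists l; split => // n; apply/ler_addgt0Pr => e e0.
have [N hN] := (cvg_nrmP _ _).1 ul e e0.
have := hN (maxn N n) (leq_maxl _ _); have := tail' (maxn N n) n (leq_maxr _ _).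
have := nrm_dist l (u (maxn N n)) (u n); lra.
Qed.

End Geometric.

(** * Zabreiko's lemma by a Baire category argument *)

Section Zabreiko.
Variables (R : realType) (V : completeNormedModType (C R)) (A : R -> set V).
Hypothesis A_le : forall c d x, c <= d -> A c x -> A d x.
Hypothesis AB : forall c d x y, A c x -> A d y -> A (c + d) (x - y).
Hypothesis AZ : forall c t x, 0 <= t -> A c x -> A (t * c) ((t%:C%C : C R) *: x).
Hypothesis A_series : forall (u : nat -> V) x c,
  (forall k, A (c * 2^-1 ^+ k) (u k)) -> series u @ \oo --> x -> A (2 * c) x.
Hypothesis A_ex : forall x, exists c, A c x.

(** Baire's argument: if no [A c] were dense in a closed ball, there would be nested closed balls
    with radii at least halved at each stage, the one of stage [n + 1] disjoint from [A n], and
    their common point would lie in no [A c]. *)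
Lemma zabreiko_ball : exists x0 r c, 0 < r /\ forall x, nrm (x0 - x) <= r ->
  forall e, 0 < e -> exists2 y, A c y & nrm (x - y) < e.
Proof.
apply: contrapT => H.
have step (n : nat) (p : V * R) : exists p' : V * R, 0 < p.2 ->
    [/\ 0 < p'.2, p'.2 <= p.2 / 2, nrm (p.1 - p'.1) <= p.2 / 2 &
      forall y, A n%:R y -> p'.2 < nrm (p'.1 - y)].
  (* The pair [(0, 0)] is a default for nonpositive radii, so that [choice] yields a total
     function. *)
  case: p => x r /=; have [r0|r0] := ltP 0 r; last by exists (0, 0).
  apply: contrapT => /forallNP h; apply: H; exists x, (r / 2), n%:R.
  split; first by rewrite divr_gt0.
  move=> x' xx' e e0; apply: contrapT => h'.
  apply: (h (x', Num.min (e / 2) (r / 2))) => _ /=; split => //.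
  - by rewrite lt_min !divr_gt0.
  - by rewrite ge_min lexx orbT.
  - move=> y Ay; rewrite gt_min; apply/orP; left.
    have [xy|] := ltP (nrm (x' - y)) e; first by case: h'; exists y.
    by move: e0; lra.
have [f fP] := choice (fun a : nat * (V * R) => step a.1 a.2).
pose fix s n : V * R := if n is m.+1 then f (m, s m) else (0, 1).
have s0 n : 0 < (s n).2.
  by elim: n => [|n IH] /=; [exact: ltr01 | have [? _ _ _] := fP (n, s n) IH].
have rS m n : (s (n + m)%N).2 <= (s n).2 * 2^-1 ^+ m.
  elim: m => [|m IH]; first by rewrite addn0 expr0 mulr1.
  rewrite addnS exprS /=; have [_ + _ _] := fP ((n + m)%N, s (n + m)%N) (s0 (n + m)%N).
  by move=> /le_trans; apply; move: IH => /=; lra.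
have lim n : exists l, (fun m => (s (n + m)%N).1) @ \oo --> l /\
    nrm (l - (s n).1) <= (s n).2.
  have [|m|l [ul lP]] := @geom_cvg R V (fun m => (s (n + m)%N).1) ((s n).2 / 2) 2^-1.
  - by lra.
  - rewrite nrmBC addnS /=; have [_ _ + _] := fP ((n + m)%N, s (n + m)%N) (s0 (n + m)%N).
    by move=> /le_trans; apply => /=; move: (rS m n); lra.
  exists l; split => //; have := lP 0%N; rewrite addn0 expr0 mulr1.
  by move=> /le_trans; apply; rewrite -mulrA (_ : 2^-1 / (1 - 2^-1) = 1) ?mulr1//; field.
have [l [ul _]] := lim 0%N.
(* Each shifted sequence comes with its own limit; these are identified with [l]. *)
have lP n : nrm (l - (s n).1) <= (s n).2.
  have [l' [ul' l'P]] := lim n.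
  suff <- : l' = l by [].
  apply/subr0_eq/nrm_eq0/eqP; rewrite eq_le nrm_ge0 andbT.
  apply/ler_addgt0Pr => e e0; rewrite add0r.
  have e2 : 0 < e / 2 by rewrite divr_gt0.
  have [N hN] := (cvg_nrmP _ _).1 ul _ e2; have [N' hN'] := (cvg_nrmP _ _).1 ul' _ e2.
  have := hN (n + maxn N N')%N; have := hN' (maxn N N') (leq_maxr _ _).
  rewrite add0n => h1 /(_ (leq_trans (leq_maxl _ _) (leq_addl _ _))) h2.
  have := nrm_dist l' (s (n + maxn N N')%N).1 l; rewrite (nrmBC (s _).1 l).
  by move: h1 h2; lra.
have [c Ac] := A_ex l.
have [n cn] : exists n : nat, c <= n%:R.
  by exists (Num.truncn c).+1; apply: ltW; exact: truncnS_gt.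
have [_ _ _ /(_ l (A_le cn Ac))] := fP (n, s n) (s0 n).
by have := lP n.+1; rewrite nrmBC => /= ?; lra.
Qed.

(* Zabreiko's lemma for a countably subadditive seminorm [p]; [A c] stands for [p <= c]. *)
Lemma zabreiko : exists2 K, 0 < K & forall x, A (K * nrm x) x.
Proof.
have [x0 [r [c [r0 h]]]] := zabreiko_ball.
(* Scaling back from the ball costs [2 * c / r] per unit of norm; the absolute value and the [1]
   make [K] positive whatever the sign of [c]. *)
pose K := `|4 * c / r| + 1.
have K0 : 0 < K by rewrite ltr_wpDl.
(* Halving step: [x0 + (r / e) x] and [x0] lie in the ball, so [A c] has points within [r / 4] of
   each. The difference of these points, scaled by [e / r], is within [e / 2] of [x]. *)
have half (p : V * R) : exists y, 0 < p.2 -> nrm p.1 <= p.2 ->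
    A (K * p.2) y /\ nrm (p.1 - y) <= p.2 / 2.
  case: p => x e /=; have [e0|] := ltP 0 e; last by exists 0 => ?; lra.
  have [xe|] := leP (nrm x) e; last by exists 0 => _ ?; lra.
  have re : 0 < r / e by rewrite divr_gt0.
  have er : e / r * (r / e) = 1 by field; rewrite !gt_eqF.
  have r4 : 0 < r / 4 by rewrite divr_gt0.
  have [|y1 Ay1 y1P] := h (x0 + ((r / e)%:C%C : C R) *: x) _ _ r4.
    rewrite opprD addrA subrr add0r nrmN nrmZ nrmR gtr0_norm//.
    by rewrite mulrAC ler_pdivrMr// ler_pM2l.
  have [|y2 Ay2 y2P] := h x0 _ _ r4; first by rewrite subrr nrm0 ltW.
  exists (((e / r)%:C%C : C R) *: (y1 - y2)) => _ _; split.
    apply: A_le (AZ _ (AB Ay1 Ay2)); last by rewrite divr_ge0 ?ltW.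
    have -> : e / r * (c + c) = 4 * c / r * (e / 2) by field; rewrite gt_eqF.
    rewrite /K; have := ler_norm (4 * c / r); have := normr_ge0 (4 * c / r).
    by move: (4 * c / r) => m m0 m1; nra.
  have -> : x - ((e / r)%:C%C : C R) *: (y1 - y2) =
      ((e / r)%:C%C : C R) *: ((x0 + ((r / e)%:C%C : C R) *: x - y1) - (x0 - y2)).
    have E (w : V) : (x0 + w - y1) - (x0 - y2) = w - (y1 - y2).
      rewrite !opprB -addrA [- y1 + _]addrA [x0 + w]addrC -addrA.
      by rewrite [x0 + (_ - _)]addrC subrK addrC addrC [- y1 + _]addrC.
    by rewrite E [RHS]scalerBr scalerA -rmorphM er scale1r.
  rewrite nrmZ nrmR gtr0_norm; last by rewrite divr_gt0.
  rewrite mulrAC ler_pdivrMr// mulrAC -mulrA ler_pM2l//.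
  by have := nrmB (x0 + ((r / e)%:C%C : C R) *: x - y1) (x0 - y2); lra.
have [g gP] := choice half.
exists (2 * K); first by rewrite mulr_gt0.
(* The halving step needs a positive radius, so the zero vector is treated apart, by scaling with
   0. *)
move=> x; have [x_0|x_n0] := eqVneq (nrm x) 0.
  have [d Ad] := A_ex x; rewrite x_0 mulr0.
  by have := AZ (lexx 0) Ad; rewrite (nrm_eq0 x_0) scaler0 mul0r.
have e0 : 0 < nrm x by rewrite lt_neqAle eq_sym x_n0 nrm_ge0.
pose e k := nrm x * 2^-1 ^+ k.
have e_gt0 k : 0 < e k by rewrite mulr_gt0// exprn_gt0// invr_gt0.
(* [y k] is the remainder after [k] corrections; it tends to 0, so [x] is the sum of the corrections
   and [A_series] applies. *)
pose fix y k : V := if k is j.+1 then y j - g (y j, e j) else x.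
have yP k : nrm (y k) <= e k.
  elim: k => [|k IH]; first by rewrite /e expr0 mulr1.
  have [_] := gP (y k, e k) (e_gt0 k) IH; move=> /le_trans; apply.
  by rewrite /e exprS /=; lra.
rewrite -mulrA; apply: (A_series (u := fun k => g (y k, e k))).
  move=> k; have [+ _] := gP (y k, e k) (e_gt0 k) (yP k).
  by rewrite /e mulrA.
have sE k : x - series (fun k => g (y k, e k)) k = y k.
  elim: k => [|k IH]; first by rewrite /series /= big_geq// subr0.
  by rewrite seriesSr opprD addrA IH.
apply/cvg_nrmP => d d0.
have [N hN] := geom_small (nrm x) (q := 2^-1) (e := d) ltac:(lra) d0.
by exists N => n Nn; rewrite sE; exact: le_lt_trans (yP n) (hN _ Nn).
Qed.

End Zabreiko.

(** * Continuity and compactness on the closed disc, and square roots on the unit circle *)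

Section ClosedDisc.
Variable R : realType.
Implicit Types (F G : C R -> C R) (z w : C R).

Lemma within_cdiscP F : {within cdisc R, continuous F} <->
  forall z, cdisc R z -> forall e : R, 0 < e -> exists2 d : R, 0 < d &
    forall w, cdisc R w -> nrm (z - w) < d -> nrm (F z - F w) < e.
Proof.
split.
  move=> /subspace_continuousP Fc z Dz e e0.
  have /(Fc z Dz) : nbhs (F z) [set y | nrm (F z - y) < e].
    by apply/(nbhs_nrmP (V := C R)); exists e.
  move=> /(nbhs_nrmP (V := C R))[d d0 dP]; exists d => // w Dw zw.
  exact: dP zw Dw.
move=> h; apply/subspace_continuousP => z Dz A /(nbhs_nrmP (V := C R))[e e0 eA].
have [d d0 dP] := h z Dz e e0.
apply/(nbhs_nrmP (V := C R)); exists d => // w zw Dw; apply: eA; exact: dP.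
Qed.

Lemma within_cdiscB F G : {within cdisc R, continuous F} ->
  {within cdisc R, continuous G} -> {within cdisc R, continuous (fun w => F w - G w)}.
Proof.
move=> Fc Gc z.
exact: (@continuousB _ (C R) (subspace (cdisc R)) F G z (Fc z) (Gc z)).
Qed.

Lemma within_cdiscM F G : {within cdisc R, continuous F} ->
  {within cdisc R, continuous G} -> {within cdisc R, continuous (fun w => F w * G w)}.
Proof.
move=> Fc Gc z.
exact: (@continuousM (C R) (subspace (cdisc R)) F G z (Fc z) (Gc z)).
Qed.

Lemma within_cdisc_cst (a : C R) : {within cdisc R, continuous (fun=> a)}.
Proof. exact/continuous_subspaceT/cst_continuous. Qed.

Lemma cdisc_adherent z (d : R) : cdisc R z -> 0 < d ->
  exists2 w, disc R w & nrm (z - w) < d.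
Proof.
rewrite cdiscE => z1 d0; pose t := Num.min (2^-1) (d / 2).
have t0 : 0 < t by rewrite lt_min; lra.
have t1 : t <= 2^-1 by rewrite ge_min lexx.
have td : t <= d / 2 by rewrite ge_min lexx orbT.
exists ((1 - t)%:C%C * z).
  rewrite discE nrmM nrmR ger0_norm; last by lra.
  by have := nrm_ge0 z; nra.
have -> : z - (1 - t)%:C%C * z = t%:C%C * z by rewrite rmorphB rmorph1; ring.
by rewrite nrmM nrmR gtr0_norm//; have := nrm_ge0 z; nra.
Qed.

Lemma closed_disc_le F (c : R) : {within cdisc R, continuous F} ->
  (forall w, disc R w -> nrm (F w) <= c) -> forall z, cdisc R z -> nrm (F z) <= c.
Proof.
move=> /within_cdiscP Fc h z Dz; apply/ler_addgt0Pr => e e0.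
have [d d0 dP] := Fc z Dz e e0.
have [w Dw zw] := cdisc_adherent Dz d0.
have cDw : cdisc R w by rewrite cdiscE ltW// -discE.
have := nrmD (F z - F w) (F w); rewrite subrK.
by have := dP w cDw zw; have := h w Dw; lra.
Qed.

Lemma closed_disc_eq F G : {within cdisc R, continuous F} ->
  {within cdisc R, continuous G} -> (forall w, disc R w -> F w = G w) ->
  forall z, cdisc R z -> F z = G z.
Proof.
move=> Fc Gc h z Dz; apply/subr0_eq/nrm_eq0/eqP; rewrite eq_le nrm_ge0 andbT.
apply: (closed_disc_le (F := fun w => F w - G w)) Dz => [w|w Dw].
  exact: within_cdiscB.
by rewrite h// subrr nrm0.
Qed.

Lemma within_horner (q : {poly C R}) : {within cdisc R, continuous (horner q)}.
Proof.
apply: continuous_subspaceT; elim/poly_ind: q => [|q c IH] z.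
  rewrite (_ : horner 0 = fun=> 0); first exact: cst_continuous.
  by apply/funext => w; rewrite horner0.
rewrite (_ : horner _ = fun w => q.[w] * w + c).
  apply: (@continuousD _ (C R) (C R) (fun w => q.[w] * w) (cst c)).
    by apply: (@continuousM (C R) (C R) (horner q) id); [exact: IH|exact: cvg_id].
  exact: cst_continuous.
by apply/funext => w; rewrite !hornerE.
Qed.

Lemma nrm_i : nrm ('i%C : C R) = 1.
Proof.
have : nrm ('i%C : C R) ^+ 2 = 1.
  by rewrite expr2 -nrmM -expr2 sqr_i nrmN nrm1.
by move=> /eqP; rewrite sqrp_eq1 ?nrm_ge0// => /eqP.
Qed.

Lemma nrm_Re z : `|complex.Re z| <= nrm z.
Proof. by rewrite -lecR nrmE; exact: normc_ge_Re. Qed.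

Lemma nrm_Im z : `|complex.Im z| <= nrm z.
Proof.
by rewrite -normrN -ReiNIm (le_trans (nrm_Re _))// nrmM nrm_i mulr1.
Qed.

(** Compactness of the closed disc, in the form: a local bound is a global one. It is drawn from the
    compact square [[-1, 1] * [-1, 1]] in real coordinates. *)
Lemma cdisc_locally_bounded (P : R -> C R -> Prop) :
  (forall c d z, c <= d -> P c z -> P d z) ->
  (forall z, cdisc R z -> exists c d : R, 0 < d /\
     forall w, cdisc R w -> nrm (z - w) < d -> P c w) ->
  exists c, forall z, cdisc R z -> P c z.
Proof.
move=> P_le Ploc.
pose z (p : R * R) : C R := Complex p.1 p.2.
have zB (p p' : R * R) : nrm (z p - z p') <= `|p.1 - p'.1| + `|p.2 - p'.2|.
  have -> : z p - z p' = (p.1 - p'.1)%:C%C + 'i%C * (p.2 - p'.2)%:C%C.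
    by rewrite /z; apply/eqP; rewrite eq_complex /=; apply/andP; split; apply/eqP; ring.
  by rewrite (le_trans (nrmD _ _))// nrmM !nrmR nrm_i mul1r.
have cpt : compact (`[-1, 1] `*` `[-1, 1] : set (R * R)).
  by apply: compact_setX; exact: segment_compact.
have /compact_near_coveringP/(_ R (pinfty_nbhs R)
    (fun M p => cdisc R (z p) -> P M (z p))) := cpt.
case.
  move=> p _.
  have [c [d [d0 dP]]] : exists c d : R, 0 < d /\
      forall w, cdisc R w -> nrm (z p - w) < d -> P c w.
    have [Dz|nDz] := pselect (cdisc R (z p)); first exact: Ploc.
    have z1 : 1 < nrm (z p) by rewrite ltNge; apply/negP; rewrite -cdiscE.
    (* A ball of this radius misses the closed disc, so any constant serves. *)
    exists 0, (nrm (z p) - 1); rewrite subr_gt0; split => // w.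
    rewrite cdiscE => w1 zw; exfalso.
    by have := nrmD (z p - w) w; rewrite subrK; lra.
  have d2 : 0 < d / 2 by rewrite divr_gt0.
  exists ([set p' | ball p (d / 2) p'], [set M | c < M]).
    split => /=; first exact: nbhsx_ballx.
    by exists c; split => //; exact: num_real.
  move=> [p' M] /= [[p1 p2] cM] Dz.
  apply: (P_le c); first exact: ltW.
  apply: dP => //; rewrite (le_lt_trans (zB _ _))//.
  by rewrite /ball /= in p1 p2; lra.
move=> M [_ MP]; exists (M + 1) => w Dw.
have [a b] : `|complex.Re w| <= 1 /\ `|complex.Im w| <= 1.
  move: Dw; rewrite cdiscE => w1.
  by split; [exact: le_trans (nrm_Re w) w1|exact: le_trans (nrm_Im w) w1].
have -> : w = z (complex.Re w, complex.Im w) by case: (w).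
apply: MP => //=; first by lra.
split => /=; rewrite in_itv /= -ler_norml//.
by case: (w) Dw.
Qed.

(** By the parallelogram law one of the two signs of [b'] makes [nrm (a' + b')] at least the square
    root of 2, which exceeds 4/3; then [a - b = (a' - b') * (a' + b')] gives the contraction. *)
Lemma sqrt_unit_close (a b : C R) : nrm a = 1 -> nrm b = 1 -> exists a' b' : C R,
  [/\ a' ^+ 2 = a, b' ^+ 2 = b, nrm a' = 1, nrm b' = 1 &
      nrm (a' - b') <= 3 / 4 * nrm (a - b)].
Proof.
move=> a1 b1.
have sq (x y : C R) : nrm x = 1 -> y ^+ 2 = x -> nrm y = 1.
  move=> x1 yx; have : nrm y ^+ 2 = 1 by rewrite expr2 -nrmM -expr2 yx.
  by move=> /eqP; rewrite sqrp_eq1 ?nrm_ge0// => /eqP.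
pose a' : C R := sqrtc a; pose b0 : C R := sqrtc b.
have a'a : a' ^+ 2 = a by exact: sqr_sqrtc.
have b0b : b0 ^+ 2 = b by exact: sqr_sqrtc.
have a'1 := sq _ _ a1 a'a; have b01 := sq _ _ b1 b0b.
suff [b' [b'b ab']] : exists b', b' ^+ 2 = b /\ 4 / 3 <= nrm (a' + b').
  have b'1 := sq _ _ b1 b'b.
  exists a', b'; split => //.
  have : nrm (a' - b') * nrm (a' + b') = nrm (a - b).
    by rewrite -nrmM -a'a -b'b; congr nrm; ring.
  by have := nrm_ge0 (a' - b'); nra.
have par : nrm (a' + b0) ^+ 2 + nrm (a' - b0) ^+ 2 = 4.
  have nn (x : C R) : ((nrm x) ^+ 2)%:C%C = x * x^* :> C R.
    by rewrite rmorphXn /= nrmE; exact: normCK.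
  apply: (@complexI R); rewrite rmorphD /= !nn rmorphD rmorphB.
  have := nn a'; have := nn b0; rewrite a'1 b01 expr1n rmorph1 => hb ha.
  rewrite (_ : _ + _ = 2 * (a' * a'^*) + 2 * (b0 * b0^*)); last by ring.
  by rewrite -ha -hb rmorph_nat; ring.
have [h|h] := leP (4 / 3) (nrm (a' + b0)); first by exists b0.
exists (- b0); rewrite sqrrN; split => //.
have := nrm_ge0 (a' + b0); have := nrm_ge0 (a' - b0); nra.
Qed.

End ClosedDisc.

(** * The Cauchy-Schwarz inequality *)

Section CauchySchwarz.
Variables (R : realType) (H : completeNormedModType (C R)) (ip : H -> H -> C R).
Hypothesis hip : is_inner_product ip.

Lemma ip_self (x : H) : ip x x = ((nrm x) ^+ 2)%:C%C.
Proof. by have [_ _ ->] := hip; rewrite rmorphXn /= nrmE. Qed.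

Lemma cauchy_schwarz (x y : H) : nrm (ip x y) <= nrm x * nrm y.
Proof.
have [lin herm _] := hip.
have ip0 z : ip 0 z = 0.
  by have := lin (-1) 0 0 z; rewrite scaler0 add0r mulN1r addNr.
have [y0|yn0] := eqVneq (nrm y) 0.
  by rewrite (nrm_eq0 y0) herm ip0 rmorph0 !nrm0 mulr0.
pose t : C R := ((nrm y) ^+ 2)%:C%C; pose a := ip x y.
(* Expanding the square of this vector avoids dividing by [nrm y]; the added 0 gives the inner sum
   the shape required by linearity of [ip]. *)
pose v := t *: x + (- a *: y + 0).
have ipv z : ip v z = t * ip x z - a * ip y z by rewrite !lin ip0 addr0 mulNr.
have tJ : t^* = t by apply: CrealP; apply/complex_realP; exists (nrm y ^+ 2).
have vv : ip v v = t * (t * ip x x - a * a^*).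
  rewrite ipv (herm v x) (herm v y) !ipv -/a (herm x y) -/a (ip_self y) -/t.
  rewrite !(rmorphB, rmorphM) /= tJ conjCK -herm; ring.
have y2 : 0 < nrm y ^+ 2 by rewrite exprn_gt0// lt_neqAle eq_sym yn0 nrm_ge0.
have aa : a * a^* = ((nrm a) ^+ 2)%:C%C by rewrite rmorphXn /= nrmE; exact/esym/normCK.
have : 0 <= nrm v ^+ 2 by rewrite sqr_ge0.
rewrite -ler0c -ip_self vv ip_self aa -!(rmorphM, rmorphB) ler0c pmulr_rge0// subr_ge0.
by rewrite -exprMn ler_sqr ?nnegrE ?mulr_ge0 ?nrm_ge0// mulrC.
Qed.

End CauchySchwarz.

(** * Pointwise algebra in the function space *)

Section FunctionSpace.
Variables (R : realType) (H : completeNormedModType (C R)).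
Variables (ip : H -> H -> C R) (ev : H -> C R -> C R) (Mz : H -> H).
Variable kappa : C R -> C R -> C R.
Hypothesis fhs : functional_hilbert_space ip ev kappa.
Hypothesis kappa0 : forall w, disc R w -> kappa w 0 = 1.
Hypothesis dense_poly : closure (poly_elements ev) = setT.
Hypothesis MzE : is_Mz ev Mz.
Hypothesis alg : is_algebra ev.
Implicit Types (f g h x y : H) (z : C R) (q : {poly C R}).

Lemma ev_inj f g : (forall z, disc R z -> ev f z = ev g z) -> f = g.
Proof. by have [_ _ + _ _] := fhs; apply. Qed.

Lemma evZD (a : C R) f g z : ev (a *: f + g) z = a * ev f z + ev g z.
Proof. by have [_ + _ _ _] := fhs; apply. Qed.

Lemma ev0 z : ev 0 z = 0.
Proof. by have := evZD (-1) 0 0 z; rewrite scaler0 add0r mulN1r addNr. Qed.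

Lemma evZ (a : C R) f z : ev (a *: f) z = a * ev f z.
Proof. by rewrite -[a *: f]addr0 evZD ev0 addr0. Qed.

Lemma evD f g z : ev (f + g) z = ev f z + ev g z.
Proof. by rewrite -[f]scale1r evZD mul1r scale1r. Qed.

Lemma evN f z : ev (- f) z = - ev f z.
Proof. by rewrite -scaleN1r evZ mulN1r. Qed.

Lemma evB f g z : ev (f - g) z = ev f z - ev g z.
Proof. by rewrite evD evN. Qed.

Lemma disc0 : disc R 0. Proof. by rewrite discE nrm0 ltr01. Qed.

Lemma ev_ker w : disc R w -> exists k : H, forall f, ip f k = ev f w.
Proof. by have [_ _ _ _ rk] := fhs => /rk[k [_ kE]]; exists k. Qed.

(** By (A1) the kernel function at 0 is the constant 1. *)
Lemma one_ex : exists f : H, forall z, disc R z -> ev f z = 1.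
Proof.
have [_ _ _ _ /(_ _ disc0)[k [kE _]]] := fhs.
by exists k => z Dz; rewrite kE// kappa0.
Qed.

Definition one : H := sval (cid one_ex).

Lemma ev1 z : disc R z -> ev one z = 1.
Proof. exact: (svalP (cid one_ex)). Qed.

Definition mul f g : H := sval (cid (alg f g)).

Lemma evM f g z : disc R z -> ev (mul f g) z = ev f z * ev g z.
Proof. exact: (svalP (cid (alg f g))). Qed.

Local Definition evE := (evM, ev1, evB, evN, evD, evZ, ev0).

Local Ltac pointwise := apply: ev_inj => ? ?; rewrite ?evE//; try ring.

Lemma mulC f g : mul f g = mul g f. Proof. pointwise. Qed.
Lemma mulA f g h : mul f (mul g h) = mul (mul f g) h. Proof. pointwise. Qed.
Lemma mul1 f : mul one f = f. Proof. pointwise. Qed.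
Lemma mulBr f g h : mul f (g - h) = mul f g - mul f h. Proof. pointwise. Qed.
Lemma mulZr a f g : mul f (a *: g) = a *: mul f g. Proof. pointwise. Qed.

(** * Joint continuity of the product and boundedness of evaluations *)

Lemma ev_cont w : disc R w -> exists2 k, 0 < k & forall f, nrm (ev f w) <= k * nrm f.
Proof.
have [hip _ _ _ _] := fhs; move=> /ev_ker[k kE]; exists (nrm k + 1).
  by rewrite ltr_wpDl ?nrm_ge0.
move=> f; rewrite -kE (le_trans (cauchy_schwarz hip _ _))// mulrC.
by rewrite ler_wpM2r ?nrm_ge0// lerDl.
Qed.

Lemma ev_cvg (u : nat -> H) x w : disc R w -> u @ \oo --> x ->
  (fun n => ev (u n) w) @ \oo --> (ev x w : C R).
Proof.
move=> /ev_cont[k k0 kP] /cvg_nrmP ux; apply/cvg_nrmP => e e0.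
have [N hN] := ux (e / k) (divr_gt0 e0 k0); exists N => n /hN.
rewrite ltr_pdivlMr// => h; rewrite -evB (le_lt_trans (kP _))//.
by rewrite mulrC.
Qed.

(** Evaluations are continuous and separate the elements of [H], so both limits can be compared
    pointwise. *)
Lemma mul_closed_graph f (u : nat -> H) x y :
  u @ \oo --> x -> (fun n => mul f (u n)) @ \oo --> y -> mul f x = y.
Proof.
move=> ux fuy; apply: ev_inj => z Dz; rewrite evM//.
apply: (@cvg_unique _ (@norm_hausdorff _ (C R)) ((fun n => ev (mul f (u n)) z) @ \oo)).
  have -> : (fun n => ev (mul f (u n)) z) = (fun n => ev f z * ev (u n) z).
    by apply/funext => n; rewrite evM.
  by apply: cvgMr; exact: ev_cvg.
exact: ev_cvg Dz fuy.
Qed.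

(** The images of the partial sums converge geometrically, and the closed graph identifies their
    limit. This is the countable subadditivity that [zabreiko] asks for. *)
Lemma mul_series f (u : nat -> H) x c :
  (forall k, nrm (mul f (u k)) <= c * 2^-1 ^+ k) -> series u @ \oo --> x ->
  nrm (mul f x) <= 2 * c.
Proof.
move=> uc ux.
have sE n : mul f (series u n.+1) - mul f (series u n) = mul f (u n).
  by rewrite -mulBr seriesSr addrAC subrr add0r.
have [|n|y [uy yP]] := @geom_cvg R H (fun n => mul f (series u n)) c 2^-1.
- by lra.
- by rewrite sE.
rewrite (mul_closed_graph ux uy).
have := yP 0%N; have -> : mul f (series u 0%N) = 0.
  by rewrite /series /= big_geq//; pointwise.
by rewrite subr0 expr0 mulr1 (_ : c / (1 - 2^-1) = 2 * c)//; field.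
Qed.

(** First use of [zabreiko], for the seminorm sending [g] to [nrm (mul f g)], in the role of the
    closed graph theorem. *)
Lemma mulr_bounded f : exists2 K, 0 < K & forall g, nrm (mul f g) <= K * nrm g.
Proof.
apply: (@zabreiko R H (fun c g => nrm (mul f g) <= c)) => /=.
- by move=> c d g cd /le_trans; apply.
- move=> c d g h gc hd; rewrite mulBr (le_trans (nrmB _ _))//; exact: lerD.
- by move=> c t g t0 gc; rewrite mulZr nrmZ nrmR ger0_norm// ler_wpM2l.
- by move=> u g c; exact: mul_series.
- by move=> g; exists (nrm (mul f g)).
Qed.

(** Second use, for the operator norm of multiplication by [f], which is finite by [mulr_bounded],
    in the role of the uniform boundedness principle. *)
Lemma mul_bounded : exists2 K, 0 < K & forall f g, nrm (mul f g) <= K * nrm f * nrm g.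
Proof.
apply: (@zabreiko R H (fun c f => forall g, nrm (mul f g) <= c * nrm g)) => /=.
- by move=> c d f cd fc g; rewrite (le_trans (fc g))// ler_wpM2r ?nrm_ge0.
- move=> c d f h fc hd g; rewrite mulC mulBr ![mul g _]mulC mulrDl.
  by rewrite (le_trans (nrmB _ _))// lerD.
- move=> c t f t0 fc g; rewrite mulC mulZr nrmZ nrmR ger0_norm// mulC -mulrA.
  by rewrite ler_wpM2l.
- move=> u f c uc uf g; rewrite mulC -mulrA; apply: mul_series uf => k.
  by rewrite mulC mulrAC.
- by move=> f; have [K _ fK] := mulr_bounded f; exists K.
Qed.

Definition K := s2val (cid2 mul_bounded).

Lemma K_gt0 : 0 < K. Proof. exact: (s2valP (cid2 mul_bounded)). Qed.

Lemma K_ge0 : 0 <= K. Proof. exact: ltW K_gt0. Qed.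

Lemma nrm_mul f g : nrm (mul f g) <= K * nrm f * nrm g.
Proof. exact: (s2valP' (cid2 mul_bounded)). Qed.

(** With [k] the kernel function at [z], the inner product of [mul f k] and [k] is [ev f z] times
    the square of [nrm k]; Cauchy-Schwarz and the bound on products conclude after division. Here
    [k] is nonzero because it evaluates [one] to 1. *)
Lemma ev_le f z : disc R z -> nrm (ev f z) <= K * nrm f.
Proof.
move=> Dz; have [hip _ _ _ _] := fhs; have [k kE] := ev_ker Dz.
have kk : nrm (ev k z) = nrm k ^+ 2.
  by rewrite -kE (ip_self hip) nrmR ger0_norm// sqr_ge0.
have k0 : 0 < nrm k ^+ 2.
  rewrite exprn_gt0// lt_neqAle nrm_ge0 andbT; apply/eqP => /esym/nrm_eq0 k0.
  have := cauchy_schwarz hip one k; rewrite kE ev1// nrm1 k0 nrm0 mulr0; lra.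
rewrite -(ler_pM2r k0) -[in leLHS]kk -nrmM -evM// -kE expr2 mulrA.
rewrite (le_trans (cauchy_schwarz hip _ _))// ler_wpM2r ?nrm_ge0//.
exact: nrm_mul.
Qed.

(** * Polynomials, continuous extensions and ideals *)

Lemma pol_ex q : exists f : H, forall z, disc R z -> ev f z = q.[z].
Proof.
elim/poly_ind: q => [|q c [f fE]]; first by exists 0 => z Dz; rewrite ev0 horner0.
by exists (c *: one + Mz f) => z Dz; rewrite !evE// MzE// fE// !hornerE; ring.
Qed.

Definition pol q : H := sval (cid (pol_ex q)).

Lemma ev_pol q z : disc R z -> ev (pol q) z = q.[z].
Proof. exact: (svalP (cid (pol_ex q))). Qed.

Lemma pol_dense f (e : R) : 0 < e -> exists q, nrm (f - pol q) < e.
Proof.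
move=> e0; have : closure (poly_elements ev) f by rewrite dense_poly.
move=> /(_ [set y | nrm (f - y) < e])[]; first by apply/nbhs_nrmP; exists e.
move=> p [[q qE] pe]; exists q; suff -> : pol q = p by [].
by apply: ev_inj => z Dz; rewrite ev_pol// qE.
Qed.

Lemma polB (p q : {poly C R}) : pol (p - q) = pol p - pol q.
Proof. by apply: ev_inj => z Dz; rewrite evB !ev_pol// hornerD hornerN. Qed.

Lemma polM (p q : {poly C R}) : pol (p * q) = mul (pol p) (pol q).
Proof. by apply: ev_inj => z Dz; rewrite evM// !ev_pol// hornerM. Qed.

Lemma pol_le q z : cdisc R z -> nrm q.[z] <= K * nrm (pol q).
Proof.
apply: closed_disc_le; first exact: within_horner.
by move=> w Dw; rewrite -(ev_pol q Dw) ev_le.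
Qed.

(** The value is the limit of [(q n).[z]] along polynomials tending to [f]. Comparing it with every
    polynomial at once makes the estimate uniform in [z]. *)
Lemma cdisc_value f z : cdisc R z ->
  exists c : C R, forall q, nrm (c - q.[z]) <= K * nrm (f - pol q).
Proof.
move=> Dz.
have [q qP] := choice (fun n : nat =>
  pol_dense f (exprn_gt0 n (ltac:(lra) : 0 < 2^-1 :> R))).
have close n p : nrm ((q n).[z] - p.[z]) <= K * (2^-1 ^+ n + nrm (f - pol p)).
  have -> : (q n).[z] - p.[z] = (q n - p).[z] by rewrite hornerD hornerN.
  rewrite (le_trans (pol_le _ Dz))// ler_wpM2l ?K_ge0// polB.
  rewrite (le_trans (nrm_dist _ f _))// lerD2r nrmBC; exact/ltW/qP.
(* [geom_cvg] is applied in [H] to constant functions; the limit value is then read off by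
   evaluation at 0. *)
have [|n|l [ul lP]] :=
    @geom_cvg R H (fun n => (q n).[z] *: one) (2 * K * nrm one) 2^-1.
- by lra.
- rewrite -scalerBl nrmZ nrmBC mulrAC ler_wpM2r ?nrm_ge0//.
  rewrite (le_trans (close _ _))//.
  have := qP n.+1; have := exprn_ge0 n (ltac:(lra) : 0 <= 2^-1 :> R).
  rewrite exprS => h0 h1; rewrite [2 * K]mulrC -mulrA ler_wpM2l ?K_ge0//.
  by lra.
exists (ev l 0) => p; apply/ler_addgt0Pr => e e0.
have e2 : 0 < e / 2 by rewrite divr_gt0.
have /(cvg_nrmP (V := C R))/(_ _ e2)[N hN] := ev_cvg disc0 ul.
have [N' hN'] := geom_small K (q := 2^-1) ltac:(lra) e2.
have := hN (maxn N N') (leq_maxl _ _); have := hN' (maxn N N') (leq_maxr _ _).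
rewrite evZ ev1 ?mulr1; last exact: disc0.
have := close (maxn N N') p; rewrite mulrDr.
have := nrm_dist (ev l 0 : C R) (q (maxn N N')).[z] p.[z]; lra.
Qed.

(** [F] is a uniform limit of polynomials on the closed disc, hence continuous, and [ev_le] shows
    that the same polynomials converge to [ev f] inside. *)
Lemma extension_ex f : exists F, continuous_extension ev f F.
Proof.
have val z : exists c : C R,
    cdisc R z -> forall q, nrm (c - q.[z]) <= K * nrm (f - pol q).
  have [Dz|nDz] := pselect (cdisc R z); last by exists 0.
  by have [c cP] := cdisc_value f Dz; exists c.
have [F FP] := choice val.
exists F; split.
  apply/within_cdiscP => z Dz e e0.
  have e3 : 0 < e / 3 / K by rewrite !divr_gt0 ?K_gt0.
  have [q] := pol_dense f e3; rewrite ltr_pdivlMr ?K_gt0// mulrC => qP.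
  have /within_cdiscP/(_ z Dz (e / 3)) := @within_horner R q.
  case=> [|d d0 dP]; first by rewrite divr_gt0.
  exists d => // w Dw zw; have := dP w Dw zw.
  have := FP z Dz q; have := FP w Dw q; rewrite (nrmBC (F w)).
  have := nrm_dist (F z) q.[z] (F w); have := nrm_dist q.[z] q.[w] (F w).
  by lra.
move=> z Dz; have cDz : cdisc R z by rewrite cdiscE ltW// -discE.
apply/subr0_eq/nrm_eq0/eqP; rewrite eq_le nrm_ge0 andbT.
apply/ler_addgt0Pr => e e0; rewrite add0r.
have e3 : 0 < e / 2 / K by rewrite !divr_gt0 ?K_gt0.
have [q] := pol_dense f e3; rewrite ltr_pdivlMr ?K_gt0// mulrC => qP.
have := FP z cDz q; have := ev_le (f - pol q) Dz; rewrite evB ev_pol//.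
by have := nrm_dist (F z) q.[z] (ev f z); rewrite (nrmBC q.[z]); lra.
Qed.

Lemma extension_le f F z : continuous_extension ev f F -> cdisc R z ->
  nrm (F z) <= K * nrm f.
Proof.
move=> [Fc FE]; apply: closed_disc_le => // w Dw.
by rewrite FE// ev_le.
Qed.

(** Invariance gives polynomial multiples of [f]; density and continuity of the product give all
    others. *)
Lemma mul_mem M f g : closed_invariant_subspace Mz M -> M f -> M (mul g f).
Proof.
move=> [[M0 Mlin] Mcl Minv] Mf.
have polf q : M (mul (pol q) f).
  elim/poly_ind: q => [|q c IH].
    rewrite (_ : mul _ _ = 0) //; apply: ev_inj => z Dz.
    by rewrite evM// ev_pol// horner0 mul0r ev0.
  rewrite (_ : mul _ _ = c *: f + Mz (mul (pol q) f)).
    by apply: Mlin => //; exact: Minv.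
  apply: ev_inj => z Dz; rewrite evM// ev_pol// evD evZ MzE// evM// ev_pol//.
  by rewrite hornerMXaddC; ring.
apply: (closed_nrm Mcl) => e e0.
(* The [1] keeps the divisor positive when [f] is 0. *)
pose d := K * (nrm f + 1).
have d0 : 0 < d by rewrite mulr_gt0 ?K_gt0// ltr_wpDl ?nrm_ge0.
have [q] := pol_dense g (divr_gt0 e0 d0); rewrite ltr_pdivlMr// => qP.
exists (mul (pol q) f) => //; apply: le_lt_trans qP.
rewrite mulC [mul (pol q) _]mulC -mulBr mulC (le_trans (nrm_mul _ _))//.
rewrite mulrAC mulrC ler_wpM2l ?nrm_ge0// /d ler_wpM2l ?K_ge0//.
by rewrite lerDl ler01.
Qed.

(** * Invertible elements: polynomials and the Neumann series *)

Definition inv f := exists g, mul f g = one.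

Lemma inv_mul f g : inv f -> inv g -> inv (mul f g).
Proof.
move=> [f' ff'] [g' gg']; exists (mul f' g').
by rewrite -mulA (mulA g) (mulC g) -mulA gg' mulA ff' mul1.
Qed.

Lemma inv_mull f g : inv (mul f g) -> inv f.
Proof. by move=> [h fgh]; exists (mul g h); rewrite mulA. Qed.

(** Applying the multiplier [psi] to [one] places it in [H]; conversely every element of the algebra
    [H] is a multiplier. *)
Lemma invP f : invertible_multiplier ev (ev f) <-> inv f.
Proof.
split.
  move=> [_ [psi [psim fpsi]]]; have [g gE] := psim one.
  by exists g; apply: ev_inj => z Dz; rewrite evM// gE// ev1// mulr1 fpsi.
move=> [g fg]; split.
  by move=> h; exists (mul f h) => z; exact: evM.
exists (ev g); split; first by move=> h; exists (mul g h) => z; exact: evM.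
by move=> z Dz; rewrite -evM// fg ev1.
Qed.

Hypothesis spec : spectrum Mz = cdisc R.

Lemma inv_pol q : (forall z, cdisc R z -> q.[z] != 0) -> inv (pol q).
Proof.
move=> q0; have [r qE] := closed_field_poly_normal (q : {poly R[i]}).
have rP a : a \in r -> ~ cdisc R a.
  move=> ar Da; have := q0 a Da; rewrite qE hornerZ.
  have /eqP -> : root (\prod_(z <- r) ('X - z%:P)) a by rewrite root_prod_XsubC.
  by rewrite mulr0 eqxx.
have lq0 : lead_coef (q : {poly R[i]}) != 0.
  rewrite lead_coef_eq0; apply/eqP => q00; have := q0 0.
  by rewrite cdiscE nrm0 => /(_ ler01); rewrite q00 horner0 eqxx.
have invc (c : C R) : c != 0 -> inv (pol c%:P).
  move=> c0; exists (c^-1 *: one); apply: ev_inj => z Dz.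
  by rewrite evM// ev_pol// hornerC evZ ev1// mulr1 divff.
have invX (a : C R) : ~ cdisc R a -> inv (pol ('X - a%:P)).
  (* [S] inverts [Mz - a], so [S one] is the reciprocal of [z - a]. *)
  rewrite -spec => /contrapT[S [_ _ SP]]; exists (S one); apply: ev_inj => z Dz.
  have := congr1 (fun h => ev h z) (SP one); rewrite evB evZ MzE// => <-.
  by rewrite evM// ev_pol// !hornerE; ring.
rewrite qE -mul_polyC polM; apply: inv_mul; first exact: invc.
elim: r {qE} rP => [|a r IH] rP; first by rewrite big_nil -polyC1; exact/invc/oner_neq0.
rewrite big_cons polM; apply: inv_mul.
  by apply/invX/rP; rewrite inE eqxx.
by apply: IH => b br; apply: rP; rewrite inE br orbT.
Qed.

(** Neumann series: the partial sums satisfy [s n.+1 = one + mul y (s n)], and their limit solves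
    the fixed point equation. The factor [K] enters because the norm is submultiplicative only up to
    [K]. *)
Lemma inv_one_sub y : K * nrm y <= 2^-1 -> inv (one - y).
Proof.
move=> y2; pose fix s n : H := if n is m.+1 then one + mul y (s m) else 0.
have sS n : s n.+1 = one + mul y (s n) by [].
have sP n : nrm (s n.+1 - s n) <= nrm one * 2^-1 ^+ n.
  elim: n => [|n IH].
    rewrite expr0 mulr1 /= subr0 (_ : mul y 0 = 0) ?addr0//.
    by apply: ev_inj => z Dz; rewrite evM// !ev0 mulr0.
  rewrite (sS n.+1) (sS n) opprD addrACA subrr add0r -mulBr -(sS n).
  rewrite (le_trans (nrm_mul _ _))// exprS.
  by have := nrm_ge0 (s n.+1 - s n); nra.
have [|l [sl _]] := geom_cvg (q := 2^-1) _ sP; first by lra.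
exists l; rewrite mulC mulBr [mul l one]mulC mul1 mulC.
have -> : mul y l = l - one; last by rewrite opprB addrC subrK.
apply: (mul_closed_graph sl); apply/cvg_nrmP => e e0.
have [N hN] := (cvg_nrmP _ _).1 sl e e0; exists N => n Nn.
have -> : l - one - mul y (s n) = l - s n.+1 by rewrite sS opprD addrA.
by apply: hN; exact: leqW.
Qed.

(** * Dyadic powers and their resolvents *)

Definition sqr_iter k x : H := iter k (fun y => mul y y) x.

Lemma ev_sqr_iter k x z : disc R z -> ev (sqr_iter k x) z = ev x z ^+ (2 ^ k).
Proof.
move=> Dz; elim: k => [|k IH]; first by rewrite expr1.
by rewrite /sqr_iter iterS evM// IH -exprD addnn -mul2n -expnS.
Qed.

Lemma sqr_iterM k x y : sqr_iter k (mul x y) = mul (sqr_iter k x) (sqr_iter k y).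
Proof.
by apply: ev_inj => z Dz; rewrite evM// !ev_sqr_iter// evM// exprMn.
Qed.

(** Since [1 - y^2 = (1 - y)(1 + y)], the element [1 - y] divides every [1 - y^(2^k)], and a divisor
    of an invertible element is invertible. *)
Lemma inv_sqr_iter k y : inv (one - sqr_iter k y) -> inv (one - y).
Proof.
elim: k => // k IH h; apply: IH; apply: (inv_mull (g := one + sqr_iter k y)).
suff -> : mul (one - sqr_iter k y) (one + sqr_iter k y) = one - sqr_iter k.+1 y by [].
apply: ev_inj => z Dz; rewrite evM// !(evB, evD) ev1// /sqr_iter iterS evM//; ring.
Qed.

(** The resolvent in the reciprocal of the spectral parameter, so that [l] ranges over the compact
    closed disc. As a relation it needs no inverse chosen beforehand. *)
Definition resolvent x (l : C R) a := mul a (one - l *: x) = one.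

Lemma resolventP x l a :
  resolvent x l a <-> forall z, disc R z -> ev a z * (1 - l * ev x z) = 1.
Proof.
split=> [ra z Dz|h].
  by have := congr1 (fun h => ev h z) ra; rewrite evM// evB evZ ev1.
by apply: ev_inj => z Dz; rewrite evM// evB evZ ev1// h.
Qed.

Lemma resolvent_uniq x l a b : resolvent x l a -> resolvent x l b -> a = b.
Proof.
move=> ra rb; rewrite -[a]mul1 -rb (mulC b) -mulA (mulC b) mulA (mulC _ a) ra.
by rewrite mul1.
Qed.

(** Resolvent identity: [a - b = (l - m) x a b]. *)
Lemma resolvent_dist x l m a b : resolvent x l a -> resolvent x m b ->
  nrm (a - b) <= nrm (l - m) * (K ^+ 2 * nrm x * nrm a * nrm b).
Proof.
move=> /resolventP ra /resolventP rb.
have -> : a - b = (l - m) *: mul x (mul a b).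
  apply: ev_inj => z Dz; rewrite evB evZ !evM//.
  transitivity (ev a z * (ev b z * (1 - m * ev x z)) -
    ev b z * (ev a z * (1 - l * ev x z))); last by ring.
  by rewrite ra// rb// !mulr1.
rewrite nrmZ ler_wpM2l ?nrm_ge0// (le_trans (nrm_mul _ _))//.
rewrite expr2 -!mulrA ler_wpM2l ?K_ge0// mulrCA ler_wpM2l ?nrm_ge0// mulrA.
exact: nrm_mul.
Qed.

Lemma resolvent_bounded x :
  (forall l, cdisc R l -> exists a, resolvent x l a) ->
  exists M, forall l, cdisc R l -> forall a, resolvent x l a -> nrm a <= M.
Proof.
move=> h; apply: (cdisc_locally_bounded
    (P := fun M l => forall a, resolvent x l a -> nrm a <= M)).
  by move=> c d l cd lc a /lc /le_trans; apply.
move=> l Dl; have [b rb] := h l Dl.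
pose B := K ^+ 2 * nrm x * nrm b.
have B0 : 0 <= B by do ![apply: mulr_ge0 | exact: nrm_ge0 | exact: K_ge0].
(* Within this radius [nrm (a - b)] is at most half of [nrm a], hence [nrm a <= 2 * nrm b]. *)
exists (2 * nrm b), (2^-1 / (B + 1)); split; first by rewrite divr_gt0// ltr_wpDl.
move=> m Dm lm a ra; have := resolvent_dist ra rb.
rewrite (_ : K ^+ 2 * nrm x * nrm a * nrm b = B * nrm a); last by rewrite /B; ring.
move: lm; rewrite ltr_pdivlMr ?ltr_wpDl// nrmBC => lm h1.
have := nrmD (a - b) b; rewrite subrK.
have := nrm_ge0 a; have := nrm_ge0 (m - l).
have : nrm (m - l) * (B * nrm a) <= 2^-1 * nrm a.
  rewrite mulrA ler_wpM2r ?nrm_ge0//; have := nrm_ge0 (m - l); nra.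
lra.
Qed.

(** Partial fractions: [1 / (1 - l^2 s^2)] is the mean of [1 / (1 - l s)] and [1 / (1 + l s)].
    Iteration averages resolvents of [x] over roots of unity. *)
Lemma resolvent_avg k x l a b :
  resolvent (sqr_iter k x) l a -> resolvent (sqr_iter k x) (- l) b ->
  resolvent (sqr_iter k.+1 x) (l ^+ 2) ((2^-1 : C R) *: (a + b)).
Proof.
move=> /resolventP ra /resolventP rb; apply/resolventP => z Dz.
have := ra z Dz; have := rb z Dz.
rewrite /sqr_iter iterS -/(sqr_iter k x) evM// evZ evD => hb ha.
set s := ev (sqr_iter k x) z in ha hb *.
transitivity (2^-1 * ((ev a z * (1 - l * s)) * (1 + l * s) +
  (ev b z * (1 - - l * s)) * (1 - l * s))); first by ring.
by rewrite ha hb; field.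
Qed.

(* On the unit circle a suitable branch of the square root contracts distances by 3/4, so
   the Lipschitz constants decay with [k]. *)
Lemma resolvent_lipschitz x :
  (forall l, cdisc R l -> exists a, resolvent x l a) ->
  exists L, forall k, (forall l, nrm l = 1 -> exists a, resolvent (sqr_iter k x) l a) /\
    forall l m a b, nrm l = 1 -> nrm m = 1 -> resolvent (sqr_iter k x) l a ->
      resolvent (sqr_iter k x) m b -> nrm (a - b) <= L * (3 / 4) ^+ k * nrm (l - m).
Proof.
move=> h; have [M MP] := resolvent_bounded h.
have unitD l : nrm l = 1 -> cdisc R l by rewrite cdiscE => ->.
exists (K ^+ 2 * nrm x * M * M); elim=> [|k [exk lipk]].
  split=> [l /unitD/h//|l m a b /unitD Dl /unitD Dm ra rb].
  rewrite expr0 mulr1 (le_trans (resolvent_dist ra rb))// mulrC ler_wpM2r ?nrm_ge0//.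
  have na := MP _ Dl a ra; have nb := MP _ Dm b rb.
  have B0 : 0 <= K ^+ 2 * nrm x by rewrite mulr_ge0 ?sqr_ge0 ?nrm_ge0.
  apply: ler_pM => //; [exact: mulr_ge0 (nrm_ge0 _)|exact: nrm_ge0|].
  exact: ler_wpM2l.
split=> [m m1|m m' a b m1 m'1 ra rb].
  (* The repeated argument merely supplies a square root of modulus 1. *)
  have [l [_ [lm _ l1 _ _]]] := sqrt_unit_close m1 m1.
  have [a ra] := exk l l1; have [b rb] := exk (- l) (etrans (nrmN _) l1).
  by rewrite -lm; exists ((2^-1 : C R) *: (a + b)); exact: resolvent_avg.
(* The opposite roots are equally close, so both halves of the average gain the same factor 3/4. *)
have [l [l' [lm lm' l1 l'1 ll']]] := sqrt_unit_close m1 m'1.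
have [a1 ra1] := exk l l1; have [a2 ra2] := exk (- l) (etrans (nrmN _) l1).
have [b1 rb1] := exk l' l'1; have [b2 rb2] := exk (- l') (etrans (nrmN _) l'1).
have {ra}-> : a = (2^-1 : C R) *: (a1 + a2).
  by apply: resolvent_uniq ra _; rewrite -lm; exact: resolvent_avg.
have {rb}-> : b = (2^-1 : C R) *: (b1 + b2).
  by apply: resolvent_uniq rb _; rewrite -lm'; exact: resolvent_avg.
have h1 := lipk _ _ _ _ l1 l'1 ra1 rb1.
have := lipk _ _ _ _ (etrans (nrmN _) l1) (etrans (nrmN _) l'1) ra2 rb2.
rewrite -opprD nrmN => h2.
rewrite -scalerBr opprD addrACA nrmZ.
rewrite nrm_half.
have L0 : 0 <= K ^+ 2 * nrm x * M * M * (3 / 4) ^+ k.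
  apply: mulr_ge0; last by rewrite exprn_ge0// divr_ge0.
  by rewrite -mulrA -[M * M]expr2; do ![exact: sqr_ge0 | exact: nrm_ge0 | apply: mulr_ge0].
rewrite (exprS _ k) [_ * (3 / 4 * _)]mulrCA; have := nrmD (a1 - b1) (a2 - b2).
by move: h1 h2 L0 ll'; move: (_ * (3 / 4) ^+ k) => c; nra.
Qed.

(* A form of the spectral radius formula, after Rickart. *)
Lemma sqr_iter_small x (e : R) : 0 < e ->
  (forall z, disc R z -> nrm (ev x z) < 1) ->
  (forall l, cdisc R l -> exists a, resolvent x l a) ->
  exists k, nrm (sqr_iter k x) < e.
Proof.
move=> e0 x1 h; have [L LP] := resolvent_lipschitz h.
have [a aP] := choice (fun k => (LP k).1 1 (nrm1 R)).
(* [a k] is the resolvent at 1. As 1 is the square of 1 and of -1, [a k.+1] averages [a k] with the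
   resolvent [b] at -1; the distance 2 between these points cancels the factor 1/2. *)
have aS k : nrm (a k.+1 - a k) <= L * (3 / 4) ^+ k.
  have n1 : nrm (- 1 : C R) = 1 by rewrite nrmN nrm1.
  have [b rb] := (LP k).1 _ n1.
  have -> : a k.+1 = (2^-1 : C R) *: (a k + b).
    apply: resolvent_uniq (aP k.+1) _; rewrite -[X in resolvent _ X](expr1n _ 2).
    exact: resolvent_avg (aP k) rb.
  have -> : (2^-1 : C R) *: (a k + b) - a k = (2^-1 : C R) *: (b - a k).
    by apply: ev_inj => z Dz; rewrite !(evB, evZ, evD); field.
  have := (LP k).2 _ _ _ _ n1 (nrm1 R) rb (aP k).
  have -> : nrm (- 1 - 1 : C R) = 2.
    by rewrite -opprD nrmN (_ : 1 + 1 = (2 : R)%:C%C) ?nrmR ?ger0_norm// rmorph_nat.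
  rewrite nrmZ.
  rewrite nrm_half.
  lra.
have [|y [ay yP]] := geom_cvg (q := 3 / 4) _ aS; first by lra.
(* Pointwise, the dyadic powers of [ev x z] tend to 0, so [ev (a k) z] tends to 1. *)
have y1 : y = one.
  apply: ev_inj => z Dz; rewrite ev1//.
  have xz := x1 z Dz.
  have h0 : (fun k => ev (sqr_iter k x) z) @ \oo --> (0 : C R).
    apply/(cvg_nrmP (V := C R)) => d d0.
    have [N hN] := geom_small 1 (q := nrm (ev x z)) ltac:(by rewrite nrm_ge0 xz) d0.
    exists N => k /hN; rewrite mul1r sub0r nrmN ev_sqr_iter//; apply: le_lt_trans.
    have -> : nrm (ev x z ^+ (2 ^ k)) = nrm (ev x z) ^+ (2 ^ k).
      by elim: (2 ^ k)%N => [|j IH]; rewrite ?expr0 ?nrm1// !exprS nrmM IH.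
    rewrite ler_wiXn2l ?nrm_ge0 ?ltW//; exact/ltnW/ltn_expl.
  apply: (@cvg_unique _ (@norm_hausdorff _ (C R))
      ((fun k => ev (a k) z * (1 - ev (sqr_iter k x) z)) @ \oo)).
    rewrite -[ev y z]mulr1 -[X in _ * X]subr0.
    apply: (@cvgM (C R)); first exact: ev_cvg.
    by apply: (@cvgB _ (C R)); [exact: cvg_cst|exact: h0].
  rewrite (_ : (fun _ => _) = fun=> 1); first exact: cvg_cst.
  apply/funext => k; move/resolventP/(_ z Dz) : (aP k).
  by rewrite mul1r.
(* With [t = one - a k] and [s = mul t s - t], the second bound absorbs the product into half of
   [nrm s], leaving [nrm s <= 2 * nrm t]; the first makes this less than [e]. *)
pose d := Num.min (e / 2) (2^-1 / K).
have d0 : 0 < d by rewrite lt_min !divr_gt0// K_gt0.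
have [k /(_ _ (leqnn _)) kd] :=
  geom_small (L / (1 - 3 / 4)) (q := 3 / 4) ltac:(lra) d0.
exists k; have := le_lt_trans (yP k) kd; rewrite y1 lt_min => /andP[].
set t := one - a k; set s := sqr_iter k x => te; rewrite ltr_pdivlMr ?K_gt0// => tK.
have sE : s = mul t s - t.
  have := aP k; rewrite /resolvent -/s => ra.
  apply: ev_inj => z Dz; have := congr1 (fun g => ev g z) ra.
  rewrite /t evM// !evB evM// evZ evB ev1// => rz.
  rewrite (_ : _ - (1 - _) = ev s z + (ev (a k) z * (1 - 1 * ev s z) - 1)); last by ring.
  by rewrite rz subrr addr0.
have := nrmB (mul t s) t; rewrite -sE.
have := nrm_mul t s; have := nrm_ge0 s; nra.
Qed.

(** * Invertibility of nonvanishing functions *)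

Lemma inv_of_nonvanishing f F : continuous_extension ev f F ->
  (forall z, cdisc R z -> F z != 0) -> inv f.
Proof.
move=> fF F0; have [Fc FE] := fF.
have nF z : cdisc R z -> 0 < nrm (F z).
  move=> /F0 Fz; rewrite lt_neqAle nrm_ge0 andbT eq_sym.
  by apply/eqP => /nrm_eq0/eqP; apply/negP.
have [c cP] : exists c, forall z, cdisc R z -> 1 <= c * nrm (F z).
  apply: (cdisc_locally_bounded (P := fun c z => 1 <= c * nrm (F z))).
    by move=> c d z cd /le_trans; apply; rewrite ler_wpM2r ?nrm_ge0.
  move=> z Dz; have Fz := nF z Dz.
  have [d d0 dP] := (within_cdiscP F).1 Fc z Dz _ (divr_gt0 Fz (ltr0Sn _ 1)).
  exists (2 / nrm (F z)), d; split => // w Dw /(dP w Dw) zw.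
  rewrite mulrAC ler_pdivlMr// mul1r.
  by have := nrmD (F z - F w) (F w); rewrite subrK; lra.
have D0 : cdisc R 0 by rewrite cdiscE nrm0.
have c0 : 0 < c.
  rewrite ltNge; apply/negP => c0; have := cP _ D0; have := nF _ D0; nra.
(* Half of the lower bound [1 / c] for the modulus of [F]: a polynomial [q] uniformly within [s] of
   [F] keeps its modulus above [s]. *)
pose s := 2^-1 / c.
have s0 : 0 < s by rewrite divr_gt0.
have sF z : cdisc R z -> 2 * s <= nrm (F z).
  by move=> /cP h; rewrite /s mulrA divff// mul1r -div1r ler_pdivrMr// mulrC.
have [q] := pol_dense f (divr_gt0 s0 K_gt0); rewrite ltr_pdivlMr ?K_gt0// mulrC => qf.
have qs z : cdisc R z -> s < nrm q.[z].
  move=> Dz.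
  have fq : continuous_extension ev (f - pol q) (fun w => F w - q.[w]).
    split; first exact: (@within_cdiscB R F (horner q) Fc (@within_horner R q)).
    by move=> w Dw; rewrite evB ev_pol// FE.
  have := extension_le fq Dz; have := nrmD (F z - q.[z]) q.[z]; rewrite subrK.
  by have := sF z Dz; lra.
have nzq z : cdisc R z -> q.[z] != 0.
  by move=> /qs; apply: contraTneq => ->; rewrite nrm0 -leNgt ltW.
have [g qg] := inv_pol nzq.
have qgz z : disc R z -> q.[z] * ev g z = 1.
  by move=> Dz; rewrite -ev_pol// -evM// qg ev1.
have cD z : disc R z -> cdisc R z by move=> Dz; rewrite cdiscE ltW// -discE.
pose x := (s%:C%C : C R) *: g.
have x1 z : disc R z -> nrm (ev x z) < 1.
  move=> Dz; rewrite evZ nrmM nrmR gtr0_norm//.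
  have : nrm q.[z] * nrm (ev g z) = 1 by rewrite -nrmM qgz// nrm1.
  have := qs z (cD z Dz); have := nrm_ge0 (ev g z); nra.
(* Here [x = s / q] and [1 - l x = (q - l s) / q], whose numerator has no zero because the modulus
   of [l s] is at most [s]. *)
have rx l : cdisc R l -> exists a, resolvent x l a.
  rewrite cdiscE => l1.
  have [b bP] : inv (pol (q - (l * s%:C%C)%:P)).
    apply: inv_pol => z Dz; rewrite hornerD hornerN hornerC subr_eq0.
    apply/eqP => ql; have := qs z Dz; rewrite ql nrmM nrmR gtr0_norm//.
    by nra.
  exists (mul (pol q) b); apply/resolventP => z Dz.
  have := congr1 (fun h => ev h z) bP.
  rewrite !evM// !ev_pol// ev1// hornerD hornerN hornerC evZ => hb.
  transitivity (ev b z * (q.[z] - l * s%:C%C * (q.[z] * ev g z))); first by ring.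
  by rewrite qgz// mulr1 mulrC.
have K2 : 0 < 2^-1 / K by rewrite divr_gt0 ?K_gt0.
have [k kP] := sqr_iter_small K2 x1 rx.
(* Then [f / q = 1 - h x]. Since [K * nrm h <= 1], the dyadic powers of [h] obey the same bound, and
   those of [h x] are no larger in norm than those of [x]. *)
pose h := (s^-1%:C%C : C R) *: (pol q - f).
have hK j : K * nrm (sqr_iter j h) <= 1.
  elim: j => [|j IH].
    rewrite /sqr_iter /= nrmZ nrmR gtr0_norm ?invr_gt0// nrmBC mulrCA mulrC.
    by rewrite ler_pdivrMr// mul1r ltW.
  rewrite /sqr_iter iterS -/(sqr_iter j h).
  have hh := nrm_mul (sqr_iter j h) (sqr_iter j h).
  apply: le_trans (ler_wpM2l K_ge0 hh) _; rewrite mulrCA.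
  by rewrite mulr_ile1// mulr_ge0 ?K_ge0 ?nrm_ge0.
apply: (inv_mull (g := g)).
have -> : mul f g = one - mul h x.
  apply: ev_inj => z Dz; rewrite evB !evM// ev1// /h /x !evZ evB ev_pol//.
  rewrite (_ : _ * _ * (_ * _) = (s^-1%:C%C * s%:C%C) * (q.[z] * ev g z - ev f z * ev g z)).
    by rewrite -rmorphM mulVf ?gt_eqF// rmorph1 qgz//; ring.
  by ring.
apply: (inv_sqr_iter (k := k)); apply: inv_one_sub; rewrite sqr_iterM.
move: kP; rewrite ltr_pdivlMr ?K_gt0// => kP.
apply: le_trans (ltW kP); rewrite mulrC ler_wpM2r ?K_ge0//.
by rewrite (le_trans (nrm_mul _ _))// ler_piMl ?nrm_ge0 ?hK.
Qed.

(** * Zeros, invertibility and cyclicity: the remaining implications *)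

Lemma nonvanishing_of_inv f F : continuous_extension ev f F -> inv f ->
  forall z, cdisc R z -> F z != 0.
Proof.
move=> [Fc FE] [g fg] z Dz; have [G [Gc GE]] := extension_ex g.
have FG w : disc R w -> F w * G w = 1 by move=> Dw; rewrite FE// GE// -evM// fg ev1.
have := closed_disc_eq (within_cdiscM Fc Gc) (@within_cdisc_cst R 1) FG Dz.
by move=> FGz; apply: contra_eq_neq FGz => ->; rewrite mul0r eq_sym oner_neq0.
Qed.

Lemma cyclic_of_inv f : inv f -> cyclic_vector Mz f.
Proof.
move=> [g fg] M Minv Mf; apply/seteqP; split=> // h _.
rewrite -[h]mul1 mulC; apply: mul_mem => //.
by rewrite -fg mulC; exact: mul_mem.
Qed.

(** Evaluation at [l] is bounded even on the boundary, by [extension_le], so its kernel is closed. A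
    cyclic function vanishing at [l] would force [one] into this subspace. *)
Lemma zero_set_invariant l : cdisc R l ->
  closed_invariant_subspace Mz
    [set g | exists G, continuous_extension ev g G /\ G l = 0].
Proof.
move=> Dl; split.
- split.
    exists (fun=> 0); split; last by [].
    split; first exact: within_cdisc_cst.
    by move=> z _; rewrite ev0.
  move=> a g h [G [[Gc GE] G0]] [G' [[Gc' GE'] G0']].
  (* The sum is written as a difference so that [within_cdiscB] applies. *)
  exists (fun w => a * G w - (- 1) * G' w); split; last by rewrite G0 G0' !mulr0 subrr.
  split; last first.
    by move=> z Dz; rewrite evZD GE// GE'// mulN1r opprK.
  apply: (@within_cdiscB R (fun w => a * G w) (fun w => (- 1) * G' w)).
    exact: (@within_cdiscM R (fun=> a) G (@within_cdisc_cst R a) Gc).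
  exact: (@within_cdiscM R (fun=> - 1) G' (@within_cdisc_cst R (- 1)) Gc').
- apply: nrm_closed => g h; have [G gG] := extension_ex g.
  exists G; split => //; apply/nrm_eq0/eqP; rewrite eq_le nrm_ge0 andbT.
  apply/ler_addgt0Pr => e e0; rewrite add0r; have [Gc GE] := gG.
  have [g' [G' [[Gc' GE'] G'0]]] := h _ (divr_gt0 e0 K_gt0).
  rewrite ltr_pdivlMr ?K_gt0// mulrC => gg'.
  have ext : continuous_extension ev (g - g') (fun w => G w - G' w).
    split; first exact: (@within_cdiscB R G G' Gc Gc').
    by move=> z Dz; rewrite evB GE// GE'.
  by have := extension_le ext Dl; rewrite G'0 subr0; lra.
- move=> g [G [[Gc GE] G0]]; exists (fun w => id w * G w); split; last by rewrite G0 mulr0.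
  split; last by move=> z Dz; rewrite MzE// GE.
  apply: (@within_cdiscM R id G _ Gc).
  by apply: continuous_subspaceT => w; exact: cvg_id.
Qed.

Lemma nonvanishing_of_cyclic f F : continuous_extension ev f F ->
  cyclic_vector Mz f -> forall z, cdisc R z -> F z != 0.
Proof.
move=> fF fcyc l Dl; apply/eqP => F0.
have : [set g | exists G, continuous_extension ev g G /\ G l = 0] one.
  by rewrite (fcyc _ (zero_set_invariant Dl))//; exists F.
move=> [G [[Gc GE] G0]].
have G1 w : disc R w -> G w = 1 by move=> Dw; rewrite GE// ev1.
have := closed_disc_eq Gc (@within_cdisc_cst R 1) G1 Dl.
by rewrite G0 => /eqP; rewrite eq_sym oner_eq0.
Qed.

End FunctionSpace.

Unset Implicit Arguments.

Theorem theorem3p13 (R : realType) (H : completeNormedModType (C R))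
    (ip : H -> H -> C R) (ev : H -> C R -> C R) (Mz : H -> H) :
  property_A ip ev ->
  is_Mz ev Mz ->
  is_algebra ev ->
  spectrum Mz = cdisc R ->
  [/\ (forall f : H, exists F : C R -> C R, continuous_extension ev f F),
      (forall M : set H, closed_invariant_subspace Mz M -> is_ideal ev M) &
      (forall (f : H) (F : C R -> C R), continuous_extension ev f F ->
         (cyclic_vector Mz f <-> invertible_multiplier ev (ev f)) /\
         (invertible_multiplier ev (ev f) <-> forall z, cdisc R z -> F z != 0))].
Proof.
move=> [kappa [fhs kappa0 _ dense]] MzE alg spec; split.
- exact: extension_ex fhs kappa0 dense MzE alg.
- move=> M Minv f g h Mf hE.
  have -> : h = mul alg g f.
    by apply: (ev_inj fhs) => z Dz; rewrite hE// evM// mulrC.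
  exact: (mul_mem fhs kappa0 dense MzE).
move=> f F fF; have fP := invP fhs kappa0 alg f.
have zP := inv_of_nonvanishing fhs kappa0 dense MzE alg spec fF.
split; split.
(* From (a) to (b) the argument passes through (c). *)
- by move=> /(nonvanishing_of_cyclic fhs kappa0 dense MzE alg fF)/zP/fP.
- by move=> /fP/(cyclic_of_inv dense MzE).
- by move=> /fP/(nonvanishing_of_inv dense MzE fF).
- by move=> /zP/fP.
Qed.
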